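(* Let $\mathbb K$ be a field of characteristic $0$ and let $V$ be a vector space over $\mathbb K$ of positive finite dimension. Let $(A,A^* )$ be a Leonard pair on $V$ with an arithmetic eigenvalue sequence and an arithmetic dual eigenvalue sequence. Then there exist Leonard pairs $(B,B^* )$ and $(C,C^* )$ on $V$ such that $(A,A^* )$, $(B,B^* )$ and $(C,C^* )$ are mutually adjacent.
   Context: A square matrix is tridiagonal if each nonzero entry lies on the diagonal, subdiagonal or superdiagonal; a tridiagonal matrix is irreducible if all its subdiagonal entries and all its superdiagonal entries are nonzero. A square matrix is lower bidiagonal if each nonzero entry lies on the diagonal or the subdiagonal, and upper bidiagonal if its transpose is lower bidiagonal. Bases are ordered. A Leonard pair on $V$ is an ordered pair $(A,A^* )$ of linear maps $A,A^*:V\to V$ such that (i) there is a basis of $V$ with respect to which $A$ is diagonal and $A^*$ is irreducible tridiagonal, and (ii) there is a basis of $V$ with respect to which $A^*$ is diagonal and $A$ is irreducible tridiagonal. ($A^*$ is just a name; no adjoint is meant.) A basis as in (i) is called $A$-standard, a basis as in (ii) is called $A^*$-standard, and a basis is standard for $(A,A^* )$ if it is $A$-standard or $A^*$-standard. A basis is split for $(A,A^* )$ if with respect to it one of $A,A^*$ is lower bidiagonal and the other is upper bidiagonal. Leonard pairs $(A,A^* )$ and $(B,B^* )$ on $V$ are adjacent if every basis that is standard for $(A,A^* )$ is split for $(B,B^* )$ and every basis that is standard for $(B,B^* )$ is split for $(A,A^* )$. Leonard pairs are mutually adjacent if any two of them are adjacent. Let $d=\dim V-1$. If $v_0,\dots,v_d$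 is an $A$-standard basis and $Av_i=\theta_iv_i$ for $0\le i\le d$, then $\theta_0,\dots,\theta_d$ is called an eigenvalue sequence for $(A,A^* )$. If $v_0^*,\dots,v_d^*$ is an $A^*$-standard basis and $A^*v_i^*=\theta_i^*v_i^*$ for $0\le i\le d$, then $\theta_0^*,\dots,\theta_d^*$ is called a dual eigenvalue sequence for $(A,A^* )$. A sequence $\theta_0,\dots,\theta_d$ of mutually distinct scalars of $\mathbb K$ is arithmetic if there are $\alpha,\beta\in\mathbb K$ with $\alpha\ne0$ and $\theta_i=\alpha i+\beta$ for $0\le i\le d$. *)

(* Defs.v *)
From mathcomp Require Import all_boot all_order all_algebra.

Set Implicit Arguments.
Unset Strict Implicit.
Unset Printing Implicit Defensive.

Import GRing.Theory.
Local Open Scope ring_scope.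

Section Shapes.
Variables (K : fieldType) (n : nat).
Implicit Types M : 'M[K]_n.

Definition tridiagonal M :=
  forall i j : 'I_n, M i j != 0 ->
    [|| val i == val j, val i == (val j).+1 | val j == (val i).+1].

Definition irreducible_tridiagonal M :=
  tridiagonal M /\
  forall i j : 'I_n, val i = (val j).+1 -> M i j != 0 /\ M j i != 0.

Definition lower_bidiagonal M :=
  forall i j : 'I_n, M i j != 0 ->
    (val i == val j) || (val i == (val j).+1).

Definition upper_bidiagonal M := lower_bidiagonal M^T.

Definition arithmetic (theta : 'I_n -> K) :=
  injective theta /\
  exists alpha beta : K,
    alpha != 0 /\ forall i : 'I_n, theta i = alpha * (val i)%:R + beta.

End Shapes.

Section LeonardPairs.
Variables (K : fieldType) (V : vectType K).
Implicit Types (A Astar B Bstar : 'End(V)) (v : (\dim {:V}).-tuple V).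

(* [passmx.mxof] acts on row vectors; after transposition, column j holds the
   coordinates of the image of the j-th basis vector. *)
Definition mx_wrt v A : 'M[K]_(\dim {:V}) := (passmx.mxof v v A)^T.

Definition standard_fst A Astar v :=
  [/\ basis_of {:V} v, is_diag_mx (mx_wrt v A)
    & irreducible_tridiagonal (mx_wrt v Astar)].

Definition standard_snd A Astar v := standard_fst Astar A v.

Definition Leonard_pair A Astar :=
  (exists v, standard_fst A Astar v) /\ (exists v, standard_snd A Astar v).

Definition standard A Astar v :=
  standard_fst A Astar v \/ standard_snd A Astar v.

Definition split_basis A Astar v :=
  basis_of {:V} v /\
  ((lower_bidiagonal (mx_wrt v A) /\ upper_bidiagonal (mx_wrt v Astar)) \/
   (upper_bidiagonal (mx_wrt v A) /\ lower_bidiagonal (mx_wrt v Astar))).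

Definition adjacent A Astar B Bstar :=
  (forall v, standard A Astar v -> split_basis B Bstar v) /\
  (forall v, standard B Bstar v -> split_basis A Astar v).

Definition eigenvalue_sequence A Astar (theta : 'I_(\dim {:V}) -> K) :=
  exists2 v, standard_fst A Astar v &
    forall i : 'I_(\dim {:V}), A v`_i = theta i *: v`_i.

Definition dual_eigenvalue_sequence A Astar (theta : 'I_(\dim {:V}) -> K) :=
  exists2 v, standard_snd A Astar v &
    forall i : 'I_(\dim {:V}), Astar v`_i = theta i *: v`_i.

End LeonardPairs.

(* Main.v *)
From HB Require Import structures.
Require Import Defs.
From mathcomp Require Import all_boot all_order all_algebra.
From mathcomp Require Import zify ring.

(* With d = dim V - 1, identify V with the space of binary forms of degree d.
   Two independent linear forms p, q give the basis p^i q^(d-i) and the operator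
   in sl2 whose eigenvectors are these monomials. On the basis r^i s^(d-i) this
   operator is tridiagonal; it is irreducible when the points p, q, r, s of the
   projective line are distinct, and bidiagonal when {p, q} and {r, s} share one
   point. Hence the three ways of splitting four points into two pairs,
   (pq|rs), (pr|qs) and (ps|qr), give three mutually adjacent Leonard pairs.

   Conversely, (A, A* ) is of this form: since both eigenvalue sequences are
   arithmetic, [A*,[A*,[A*,A]]] is a multiple of [A*,A]. Reading this
   Dolan-Grady relation on the second and on the first subdiagonal in an
   A-standard basis, the diagonal of A* is arithmetic and the products of
   opposite off-diagonal entries have constant second difference, so that A* is,
   up to rescaling the basis, the image of a matrix of gl2 with eigenvalues in K.

   A standard basis is unique up to rescaling and reversal, so it suffices to
   test the splitting property on the monomial bases. *)

Set Implicit Arguments.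
Unset Strict Implicit.
Unset Printing Implicit Defensive.

Import GRing.Theory.
Local Open Scope ring_scope.

(** * Matrices of endomorphisms in a basis, and independence of eigenvectors *)

Section MatrixWrt.
Context {K : fieldType} {V : vectType K}.
Local Notation n := (\dim {:V}).
Implicit Types (F G : 'End(V)) (v x : n.-tuple V).

Lemma mx_wrtE v F i j : mx_wrt v F i j = coord v i (F v`_j).
Proof. by rewrite !mxE /= passmx.vecof_delta. Qed.

Lemma mx_wrt_linear v : linear (mx_wrt v).
Proof.
move=> a F G; apply/matrixP => i j; rewrite [RHS]mxE [X in _ = X + _]mxE !mx_wrtE.
by rewrite add_lfunE scale_lfunE linearP.
Qed.
HB.instance Definition _ v := GRing.isLinear.Build K 'End(V) 'M[K]_n _ (mx_wrt v)
  (mx_wrt_linear v).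

Lemma mx_wrt_app v F (j : 'I_n) :
  basis_of {:V} v -> F v`_j = \sum_i mx_wrt v F i j *: v`_i.
Proof.
move=> vP; rewrite [LHS](coord_basis vP) ?memvf //.
by apply: eq_bigr => i _; rewrite mx_wrtE.
Qed.

Lemma mx_wrt_comp v F G :
  basis_of {:V} v -> mx_wrt v (F \o G)%VF = mx_wrt v F *m mx_wrt v G.
Proof. by move=> vP; rewrite /mx_wrt (passmx.mxof_comp _ _ vP) trmx_mul. Qed.

Lemma mx_wrt_inj v F G : basis_of {:V} v -> mx_wrt v F = mx_wrt v G -> F = G.
Proof.
by move=> vP /trmx_inj eqFG; apply: (can_inj (passmx.mxofK vP vP)).
Qed.

Lemma mx_wrt_diagP v F (theta : 'I_n -> K) : basis_of {:V} v ->
  (forall i : 'I_n, F v`_i = theta i *: v`_i) -> mx_wrt v F = diag_mx (\row_i theta i).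
Proof.
move=> vP Fv; apply/matrixP => i j.
rewrite mx_wrtE Fv linearZ /= coord_free ?(basis_free vP) // !mxE eq_sym.
by case: eqVneq => [->|_]; rewrite ?mulr1 ?mulr0.
Qed.

Lemma mx_wrt_diag_app v F (i : 'I_n) : basis_of {:V} v ->
  is_diag_mx (mx_wrt v F) -> F v`_i = mx_wrt v F i i *: v`_i.
Proof.
move=> vP /is_diag_mxP Fdiag; rewrite mx_wrt_app // (bigD1 i) //=.
by rewrite big1 ?addr0 // => j ji; rewrite Fdiag ?scale0r.
Qed.

(** Monomial change of basis. It only permutes the zero pattern, which serves the uniqueness of
    standard bases; the factor [c j / c i] serves the normalization of [Astar]. *)
Lemma mx_wrt_rescale v x F (c : 'I_n -> K) (sigma : 'I_n -> 'I_n) :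
    basis_of {:V} v -> basis_of {:V} x -> injective sigma ->
    (forall j, c j != 0) -> (forall j : 'I_n, v`_j = c j *: x`_(sigma j)) ->
  forall i j,
    mx_wrt v F i j = c j / c i * mx_wrt x F (sigma i) (sigma j).
Proof.
move=> vP xP sigma_inj c0 vx i j.
rewrite mx_wrtE vx linearZ /= mx_wrt_app // (reindex_inj sigma_inj) /=.
rewrite [X in c j *: X](_ : _ =
    \sum_k (mx_wrt x F (sigma k) (sigma j) / c k) *: v`_k); last first.
  by apply: eq_bigr => k _; rewrite vx scalerA divfK.
by rewrite linearZ /= coord_sum_free ?(basis_free vP) // mulrA mulrAC.
Qed.

Lemma eigenvectors_free F m (x : m.-tuple V) (theta : 'I_m -> K) :
    injective theta -> (forall i : 'I_m, x`_i != 0) ->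
    (forall i : 'I_m, F x`_i = theta i *: x`_i) -> free x.
Proof.
move=> theta_inj x0 Fx; apply/freeP => k kx0 i.
(* The product of the maps [F - theta a], for [a] in [s], is applied to the vanishing combination;
   the list of all indices but [i] then isolates the term of [i]. *)
have kill (s : seq 'I_m) :
    \sum_(j < m) (k j * \prod_(a <- s) (theta j - theta a)) *: x`_j = 0.
  elim: s => [|a s IHs].
    by rewrite -[RHS]kx0; apply: eq_bigr => j _; rewrite big_nil mulr1.
  move: IHs; set S := (X in X = 0) => S0.
  transitivity (F S - theta a *: S); last by rewrite S0 linear0 scaler0 subrr.
  rewrite linear_sum scaler_sumr -sumrB; apply: eq_bigr => j _ /=.
  rewrite big_cons linearZ /= Fx !scalerA -scalerBl.
  by congr (_ *: _); ring.
have := kill (rem i (enum 'I_m)); rewrite (bigD1 i) //= [X in _ + X]big1.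
  rewrite addr0 => /eqP; rewrite scaler_eq0 (negPf (x0 i)) orbF mulf_eq0.
  case/orP => [/eqP //|]; rewrite prodf_seq_eq0 => /hasP[j].
  rewrite mem_rem_uniq ?enum_uniq // inE => /andP[ji _] /=.
  by rewrite subr_eq0 (inj_eq theta_inj) eq_sym (negPf ji).
move=> j ji; rewrite (big_rem j) /= ?subrr ?mul0r ?mulr0 ?scale0r //.
by rewrite mem_rem_uniq ?enum_uniq // inE ji mem_enum.
Qed.

End MatrixWrt.

(** * Uniqueness of standard bases up to rescaling and reversal *)

Lemma path_automorphism n (g : nat -> nat) :
    (forall k, (k < n)%N -> (g k < n)%N) ->
    (forall j k, (j < n)%N -> (k < n)%N -> g j = g k -> j = k) ->
    (forall k, (k.+1 < n)%N -> g k.+1 = (g k).+1 \/ g k = (g k.+1).+1) ->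
  (forall k, (k < n)%N -> g k = k) \/ (forall k, (k < n)%N -> g k = (n.-1 - k)%N).
Proof.
move=> g_lt g_inj g_step.
have [n_le1|n_gt1] := leqP n 1.
  by left=> k ltkn; have := g_lt k ltkn; lia.
(* An injective walk cannot turn back, so its first step fixes the direction; the bound [g k < n]
   then fixes [g 0]. *)
have [up|down] := g_step 0%N n_gt1; [left|right].
- have gE : forall k, (k < n)%N -> g k = (g 0 + k)%N.
    elim/ltn_ind=> -[|[|k]] IHk ltkn; [by lia | by lia |].
    have := IHk k; have := IHk k.+1; have := @g_inj k k.+2.
    by have := g_step k.+1; lia.
  by move=> k ltkn; have := gE n.-1; have := g_lt n.-1; rewrite (gE k) //; lia.
- have gE : forall k, (k < n)%N -> (g k + k)%N = g 0%N.
    elim/ltn_ind=> -[|[|k]] IHk ltkn; [by lia | by lia |].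
    have := IHk k; have := IHk k.+1; have := @g_inj k k.+2.
    by have := g_step k.+1; lia.
  by move=> k ltkn; have := gE n.-1; have := g_lt 0%N; have := gE k ltkn; lia.
Qed.

Section StandardBases.
Context {K : fieldType} {V : vectType K}.
Local Notation n := (\dim {:V}).
Implicit Types (A Astar F G : 'End(V)) (v x : n.-tuple V).

(** Comparing coordinates in [A u = mu *: u] gives [mu = theta k] wherever the [k]-th coordinate is
    nonzero, so by injectivity only one is. *)
Lemma eigenvector_multiple A x (theta : 'I_n -> K) u mu :
    basis_of {:V} x -> injective theta ->
    (forall i : 'I_n, A x`_i = theta i *: x`_i) ->
    u != 0 -> A u = mu *: u ->
  exists2 k : 'I_n, coord x k u != 0 & u = coord x k u *: x`_k.
Proof.
move=> xP theta_inj Ax u0 Au; have uE := coord_basis xP (memvf u).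
have k_mu (k : 'I_n) : coord x k u * theta k = coord x k u * mu.
  have := congr1 (coord x k) Au; rewrite {1}uE linear_sum /=.
  rewrite (eq_bigr (fun i => (coord x i u * theta i) *: x`_i)).
    by rewrite coord_sum_free ?(basis_free xP) // => ->; rewrite linearZ mulrC.
  by move=> i _; rewrite linearZ /= Ax scalerA.
have [k uk0|u_0] := pickP (fun k => coord x k u != 0); last first.
  by case/eqP: u0; rewrite uE big1 // => i _; rewrite (eqP (negbFE (u_0 i))) scale0r.
exists k => //; rewrite {1}uE (bigD1 k) //= big1 ?addr0 // => i ik.
have [->|ui0] := eqVneq (coord x i u) 0; first by rewrite scale0r.
by case/eqP: ik; apply: theta_inj; rewrite (mulfI ui0 (k_mu i)) (mulfI uk0 (k_mu k)).
Qed.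

(** An eigenbasis [v] of [A] consists of multiples of the vectors of [x]. Entries of [Astar] between
    neighbours in [v] are nonzero, and tridiagonality on [x] makes the images of neighbours
    neighbours, so [sigma] is an automorphism of a path. *)
Lemma standard_basis_unique A Astar x v (theta : 'I_n -> K) :
    basis_of {:V} x -> injective theta ->
    (forall i : 'I_n, A x`_i = theta i *: x`_i) ->
    tridiagonal (mx_wrt x Astar) -> standard_fst A Astar v ->
  exists sigma : 'I_n -> 'I_n, exists c : 'I_n -> K,
    [/\ forall j, c j != 0, injective sigma,
        forall j : 'I_n, v`_j = c j *: x`_(sigma j)
      & (forall i, sigma i = i) \/ (forall i, sigma i = rev_ord i)].
Proof.
move=> xP theta_inj Ax Astar3 [vP Adiag [_ Astar_irr]].
have vE (j : 'I_n) : {kc : 'I_n * K | kc.2 != 0 & v`_j == kc.2 *: x`_kc.1}.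
  have vj0 : v`_j != 0.
    by apply: basis_not0 vP _; rewrite mem_nth ?size_tuple.
  apply: sig2W; have [k ? ?] :=
    eigenvector_multiple xP theta_inj Ax vj0 (mx_wrt_diag_app j vP Adiag).
  by exists (k, coord x k v`_j) => //; apply/eqP.
pose sigma j := (s2val (vE j)).1; pose c j := (s2val (vE j)).2.
have c0 j : c j != 0 by exact: (s2valP (vE j)).
have vcE (j : 'I_n) : v`_j = c j *: x`_(sigma j) by apply/eqP; exact: (s2valP' (vE j)).
have sigma_inj : injective sigma.
  move=> i j sij; apply/eqP; apply: contraT => ij.
  have := coord_free i j (basis_free vP); rewrite (negPf ij).
  rewrite vcE sij -[x`_ _](scalerK (c0 j)) -vcE scalerA linearZ /=.
  rewrite coord_free ?(basis_free vP) // eqxx mulr1 => /eqP.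
  by rewrite mulf_eq0 invr_eq0 !(negPf (c0 _)).
exists sigma, c; split=> //.
(* [g] extends [sigma] to all natural numbers; the default 0 is not reached below [n]. *)
pose g k := oapp (fun i => val (sigma i)) 0%N (insub k).
have gE (i : 'I_n) : g i = sigma i by rewrite /g valK.
have step (i j : 'I_n) : val i = (val j).+1 ->
    val (sigma i) = (sigma j).+1 \/ val (sigma j) = (sigma i).+1.
  move=> ij; have [+ _] := Astar_irr i j ij.
  rewrite (mx_wrt_rescale _ vP xP sigma_inj c0 vcE) mulf_eq0 negb_or.
  case/andP=> _ /Astar3; have : sigma i != sigma j.
    by rewrite (inj_eq sigma_inj); apply/eqP => ij'; move: ij; rewrite ij'; lia.
  by rewrite -val_eqE /=; lia.
have [|||gid|grev] := @path_automorphism n g.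
- by move=> k ltk; rewrite (gE (Ordinal ltk)).
- move=> j k ltj ltk; rewrite (gE (Ordinal ltj)) (gE (Ordinal ltk)).
  by move=> /val_inj/sigma_inj [].
- move=> k ltk; rewrite (gE (Ordinal ltk)) (gE (Ordinal (ltnW ltk))).
  exact: (step (Ordinal ltk) (Ordinal (ltnW ltk))).
- by left=> i; apply: val_inj; rewrite /= -gE gid.
- by right=> i; apply: val_inj; rewrite /= -gE grev //=; lia.
Qed.

Lemma split_basis_sym F G v : split_basis F G v -> split_basis G F v.
Proof. by case=> vP [] [? ?]; split=> //; [right | left]. Qed.

(** Reversing a basis exchanges lower and upper bidiagonal, so either choice of [sigma] leads to one
    of the two alternatives of a split basis. *)
Lemma standard_split A Astar F G x v (theta : 'I_n -> K) :
    basis_of {:V} x -> injective theta ->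
    (forall i : 'I_n, A x`_i = theta i *: x`_i) ->
    tridiagonal (mx_wrt x Astar) ->
    lower_bidiagonal (mx_wrt x F) -> upper_bidiagonal (mx_wrt x G) ->
  standard_fst A Astar v -> split_basis F G v.
Proof.
move=> xP theta_inj Ax Astar3 Flow Gup vstd.
have [sigma [c [c0 sigma_inj vE sigmaE]]] :=
  standard_basis_unique xP theta_inj Ax Astar3 vstd.
have [vP _ _] := vstd; split=> //.
have entry H i j : mx_wrt v H i j != 0 -> mx_wrt x H (sigma i) (sigma j) != 0.
  rewrite (mx_wrt_rescale _ vP xP sigma_inj c0 vE) mulf_eq0 negb_or.
  by case/andP.
case: sigmaE => sigmaE; [left | right]; split=> i j.
- by move=> /entry/Flow; rewrite !sigmaE.
- rewrite mxE => /entry nz; have := Gup (sigma i) (sigma j).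
  by rewrite mxE => /(_ nz); rewrite !sigmaE.
- rewrite mxE => /entry/Flow; rewrite !sigmaE /=.
  by have := ltn_ord i; have := ltn_ord j; lia.
- move=> /entry nz; have := Gup (sigma j) (sigma i); rewrite mxE => /(_ nz).
  by rewrite !sigmaE /=; have := ltn_ord i; have := ltn_ord j; lia.
Qed.

End StandardBases.

(** * Linear forms, and first order operators on binary forms *)

Section BinaryForms.
Variable K : fieldType.
Implicit Types (p q r s : K * K) (b : K) (d : nat).

(** The form [p.1 Y + p.2 X] at [Y = 1]. Keeping the pair retains the point at infinity [(1, 0)],
    whose polynomial is the constant 1. *)
Definition lform p : {poly K} := p.1%:P + p.2 *: 'X.

Definition det p q : K := p.1 * q.2 - p.2 * q.1.

Lemma det_same p : det p p = 0. Proof. by rewrite /det; ring. Qed.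

Lemma detC p q : det q p = - det p q. Proof. by rewrite /det; ring. Qed.

Lemma deriv_lform p : (lform p)^`() = p.2%:P.
Proof. by rewrite derivD derivC derivZ derivX add0r alg_polyC. Qed.

Lemma size_lform p : (size (lform p) <= 2)%N.
Proof.
rewrite (leq_trans (size_polyD _ _)) // geq_max.
rewrite (leq_trans (size_polyC_leq1 _)) //.
by rewrite (leq_trans (size_scale_leq _ _)) ?size_polyX.
Qed.

Lemma lform_neq0 p q : det p q != 0 -> lform p != 0.
Proof.
apply: contraNneq => p0; have p_ k : (lform p)`_k = 0 by rewrite p0 coef0.
have := p_ 1%N; have := p_ 0%N; rewrite !(coefD, coefC, coefZ, coefX) /=.
by rewrite mulr0 mulr1 addr0 add0r /det => -> ->; apply/eqP; ring.
Qed.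

Lemma lform_wronskian r q :
  (lform q)^`() * lform r - lform q * (lform r)^`() = (det r q)%:P.
Proof.
by rewrite !deriv_lform /lform /det -!mul_polyC polyCB !polyCM; ring.
Qed.

(** Cramer's rule for [p] in terms of [r] and [s]. *)
Lemma lform_plucker p r s :
  det r s *: lform p = det p s *: lform r - det p r *: lform s.
Proof. by rewrite /lform /det -!mul_polyC !polyCB !polyCM; ring. Qed.

(* For linear forms, (lform q)' * f - lform q * f' = det f q, so on degree 1 this
   is the rank one map f |-> det f q *: lform p, plus b; for general d it is the
   action of that map as a derivation on forms of degree d, dehomogenized. *)
Definition form_op d b p q (f : {poly K}) : {poly K} :=
  (lform q)^`() * lform p * f *+ d - lform p * lform q * f^`() + b *: f.

Lemma form_op_linear d b p q : linear (form_op d b p q).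
Proof.
move=> a f g; rewrite /form_op [(_ + g)^`()]derivD derivZ -!mul_polyC.
by ring.
Qed.
HB.instance Definition _ d b p q := GRing.isLinear.Build K {poly K} {poly K} _
  (form_op d b p q) (form_op_linear d b p q).

Definition form_monomial d r s i := lform r ^+ i * lform s ^+ (d - i).

Lemma size_form_monomial d r s i :
  (i <= d)%N -> (size (form_monomial d r s i) <= d.+1)%N.
Proof.
move=> leid.
have size_exp p k : (size (lform p ^+ k) <= k.+1)%N.
  apply: leq_trans (size_poly_exp_leq _ _) _.
  by rewrite ltnS; have := size_lform p; nia.
apply: leq_trans (size_polyMleq _ _) _.
by have := size_exp r i; have := size_exp s (d - i)%N; lia.
Qed.

(** Up to the term [b], the derivation replaces one factor [r] by [det r q] times [p], or one factor
    [s] by [det s q] times [p]; Cramer's rule then expands [p]. For [i = 0] and [i = d] the missing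
    neighbour has coefficient zero. *)
Lemma form_op_monomial d b p q r s i : det r s != 0 -> (i <= d)%N ->
  form_op d b p q (form_monomial d r s i) =
    (b + i%:R * (det r q * det p s / det r s)
       - (d - i)%:R * (det s q * det p r / det r s)) *: form_monomial d r s i
    - (i%:R * (det r q * det p r / det r s)) *: form_monomial d r s i.-1
    + ((d - i)%:R * (det s q * det p s / det r s)) *: form_monomial d r s i.+1.
Proof.
move=> rs0 leid; rewrite /form_monomial; set j := (d - i)%N.
have -> : (d - i.+1)%N = j.-1 by lia.
have -> : (d - i.-1)%N = (j + (0 < i))%N by lia.
have P_rs : lform p = (det p s / det r s) *: lform r - (det p r / det r s) *: lform s.
  apply: (scalerI rs0); rewrite lform_plucker scalerBr !scalerA.
  by rewrite !(mulrC (det r s)) !divfK.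
(* [W c k] is the term in which one factor [c] has been replaced, [k] being the product of the
   remaining factors. *)
pose W c k : {poly K} := ((det c q)%:P * lform p) * k.
have -> : form_op d b p q (lform r ^+ i * lform s ^+ j) =
   b *: (lform r ^+ i * lform s ^+ j)
   + W r (lform r ^+ i.-1 * lform s ^+ j) *+ i
   + W s (lform r ^+ i * lform s ^+ j.-1) *+ j.
  rewrite /form_op /W derivM !deriv_exp -!lform_wronskian.
  have -> : d = (i + j)%N by lia.
  case: i j {leid} => [|i] [|j];
    by rewrite ?mulr0n ?exprS /= -?mul_polyC ?mulrnDr; ring.
rewrite /W {W}P_rs -!mul_polyC.
by case: i j {leid} => [|i] [|j] /=; rewrite ?addn0 ?addn1 ?exprS; ring.
Qed.

End BinaryForms.

(** * The Dolan-Grady relation and the matrix entries it forces *)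

Section DolanGrady.
Variable K : fieldType.

(* [M,[M,[M,D]]] = r^2 [M,D], expanded. *)
Definition dolan_grady n (M D : 'M[K]_n) (r : K) :=
  M *m M *m M *m D - (M *m M *m D *m M) *+ 3 + (M *m D *m M *m M) *+ 3
    - D *m M *m M *m M = r ^+ 2 *: (M *m D - D *m M).

(** The triple commutator has entries [(t i - t j)^3 * T i j], and [t i - t j] is 0, [r] or [-r]
    wherever [T i j] is nonzero. *)
Lemma tridiagonal_dolan_grady n (D T : 'M[K]_n) (t : 'I_n -> K) r b :
    D = diag_mx (\row_i t i) -> (forall i, t i = r * (val i)%:R + b) ->
  tridiagonal T -> dolan_grady D T r.
Proof.
move=> -> tE T3; apply/matrixP => i j.
rewrite !mulmx_diag !(mul_diag_mx, mul_mx_diag) !mxE.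
have [->|/T3] := eqVneq (T i j) 0; first ring.
by rewrite !tE => /or3P[] /eqP ->; ring.
Qed.

Lemma dolan_grady_entry n (M D : 'M[K]_n) (t : 'I_n -> K) r i j :
    D = diag_mx (\row_i t i) -> dolan_grady M D r ->
  \sum_k \sum_l M i l * M l k * M k j * (t j - 3 * t k + 3 * t l - t i)
    = r ^+ 2 * (M i j * (t j - t i)).
Proof.
move=> DE /matrixP/(_ i j).
have -> : M *m M *m M *m D = M *m M *m (M *m D) by rewrite !mulmxA.
have -> : M *m M *m D *m M = M *m (M *m D) *m M by rewrite !mulmxA.
rewrite DE !(mul_diag_mx, mul_mx_diag) !mxE => rel.
transitivity (r ^+ 2 * (M i j * t j - t i * M i j)); last by ring.
rewrite -{}rel -!big_split -sumrB -big_split -sumrB /=.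
apply: eq_bigr => k _; rewrite !mxE !mulr_suml -!big_split -sumrB -big_split.
by rewrite -sumrB /=; apply: eq_bigr => l _; rewrite !mxE; ring.
Qed.

Lemma sum_support N (s : seq nat) (F : nat -> K) : uniq s ->
    (forall k, k \notin s -> F k = 0) -> (forall k, (N <= k)%N -> F k = 0) ->
  \sum_(k < N) F k = \sum_(k <- s) F k.
Proof.
move=> s_uniq F0 FN; rewrite -(big_mkord xpredT F) (bigID (mem s)) /=.
rewrite [X in _ + X]big1 // addr0 [RHS](bigID (fun k => k < N)%N) /=.
rewrite [X in _ = _ + X]big1 ?addr0 => [|k]; last by rewrite -leqNgt => /FN.
rewrite -big_filter -[RHS]big_filter; apply/perm_big/uniq_perm => [||k].
- by rewrite filter_uniq ?iota_uniq.
- by rewrite filter_uniq.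
- by rewrite !mem_filter mem_index_iota andbC.
Qed.

(* Indices are shifted by one, so that row and column 0 of y are zero and the
   recurrences need no boundary case. *)
Section Recurrences.
Variables (N : nat) (y : nat -> nat -> K) (r : K).
Hypothesis yN : forall i j, (N <= i)%N || (N <= j)%N -> y i j = 0.
Hypothesis y3 : forall i j, (j.+1 < i)%N || (i.+1 < j)%N -> y i j = 0.
Hypothesis rel : forall i j,
  \sum_(k < N) \sum_(l < N)
     y i l * y l k * y k j * (j%:R - 3 * k%:R + 3 * l%:R - i%:R)
    = r ^+ 2 * (y i j * (j%:R - i%:R)).

(** Tridiagonality confines [k] to the neighbourhood of [c.+1] and [l] to that of [i]; [c < i] makes
    [i] positive, so neither list has a repetition. *)
Let expand c i : (c < i)%N ->
  \sum_(k <- [:: c; c.+1; c.+2]) \sum_(l <- [:: i.-1; i; i.+1])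
     y i l * y l k * y k c.+1 * (c.+1%:R - 3 * k%:R + 3 * l%:R - i%:R)
    = r ^+ 2 * (y i c.+1 * (c.+1%:R - i%:R)).
Proof.
move=> lt_ci; rewrite -rel; symmetry.
rewrite (sum_support (N := N) (s := [:: c; c.+1; c.+2]) (F := fun k => \sum_(l < N)
  y i l * y l k * y k c.+1 * (c.+1%:R - 3 * k%:R + 3 * l%:R - i%:R))).
- apply: eq_bigr => k _.
  rewrite (sum_support (N := N) (s := [:: i.-1; i; i.+1]) (F := fun l =>
    y i l * y l k * y k c.+1 * (c.+1%:R - 3 * k%:R + 3 * l%:R - i%:R))) //=.
  + by rewrite !inE; lia.
  + by move=> l; rewrite !inE => nl; rewrite (@y3 i l) ?mul0r //; lia.
  + by move=> l nl; rewrite (@yN i l) ?mul0r //; lia.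
- by rewrite /= !inE; lia.
- move=> k; rewrite !inE => nk; rewrite big1 // => l _.
  by rewrite (@y3 k c.+1) ?mulr0 ?mul0r //; lia.
- move=> k nk; rewrite big1 // => l _.
  by rewrite (@yN k c.+1) ?mulr0 ?mul0r //; lia.
Qed.

(** A path of length three from [c.+3] to [c.+1] steps down twice and stays once, at one of three
    places, with weights 1, -2, 1. The right side of [rel] is zero there. *)
Lemma diagonal_recurrence c :
    y c.+2 c.+1 != 0 -> y c.+3 c.+2 != 0 ->
  y c.+1 c.+1 - 2 * y c.+2 c.+2 + y c.+3 c.+3 = 0.
Proof.
move=> y21 y32; have := @expand c c.+3 (leqW (leqW (leqnn _))).
rewrite !big_cons !big_nil /= (@y3 c.+3 c.+1) ?(@y3 c.+2 c) ?(@y3 c.+3 c);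
  try lia.
rewrite (@y3 c.+4 c) ?(@y3 c.+4 c.+1) ?(@y3 c.+4 c.+2); try lia.
move=> relc; apply: (mulfI y32); apply: (mulfI y21); rewrite !mulr0.
transitivity (r ^+ 2 * (0 * (c.+1%:R - c.+3%:R))); last by ring.
by rewrite -relc; ring.
Qed.

(** A path of length three from [c.+2] to [c.+1] steps down once and either stays twice, giving
    minus the square, or goes back and forth over one of three consecutive edges, with weights 2,
    -4, 2. *)
Lemma offdiagonal_recurrence c : y c.+2 c.+1 != 0 ->
  2 * (y c.+1 c * y c c.+1 - 2 * (y c.+2 c.+1 * y c.+1 c.+2)
       + y c.+3 c.+2 * y c.+2 c.+3)
    = (y c.+1 c.+1 - y c.+2 c.+2) ^+ 2 - r ^+ 2.
Proof.
move=> y21; have := @expand c c.+2 (leqW (leqnn _)).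
rewrite !big_cons !big_nil /= (@y3 c.+2 c) ?(@y3 c.+3 c) ?(@y3 c.+3 c.+1);
  try lia.
move=> relc; apply: (mulfI y21).
apply/eqP; rewrite -subr_eq0; apply/eqP.
transitivity (r ^+ 2 * (y c.+2 c.+1 * (c.+1%:R - c.+2%:R))
  - r ^+ 2 * (y c.+2 c.+1 * (c.+1%:R - c.+2%:R))); last by ring.
by rewrite -{1}relc; ring.
Qed.

End Recurrences.

Lemma second_difference_eq0 N (z : nat -> K) :
    (forall k, (k.+2 < N)%N -> z k - 2 * z k.+1 + z k.+2 = 0) ->
  forall k, (k < N)%N -> z k = (z 1%N - z 0%N) * k%:R + z 0%N.
Proof.
move=> z2; elim/ltn_ind=> -[|[|k]] IHk ltkN; [by ring | by ring |].
rewrite -[LHS]subr0 -(z2 k ltkN) (IHk k.+1) ?(IHk k); [ring | lia..].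
Qed.

(** The claimed value is a particular solution vanishing at 0 and [N]; the difference [z] is affine
    with the same two zeros. *)
Lemma second_difference_const N (x : nat -> K) kappa : N%:R != 0 :> K ->
    x 0%N = 0 -> x N = 0 ->
    (forall k, (k.+1 < N)%N -> x k - 2 * x k.+1 + x k.+2 = - (2 * kappa)) ->
  forall k, (k <= N)%N -> x k = kappa * k%:R * (N%:R - k%:R).
Proof.
move=> N0 x0 xN x2; pose z k := x k - kappa * k%:R * (N%:R - k%:R).
have zE k : (k < N.+1)%N -> z k = (z 1%N - z 0%N) * k%:R + z 0%N.
  apply: second_difference_eq0 => {}k ltkN.
  by rewrite /z -[RHS](subrr (- (2 * kappa))) -{1}(x2 k ltkN); ring.
have z0 : z 0%N = 0 by rewrite /z x0; ring.
have z1 : z 1%N = 0.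
  have := zE N (ltnSn N); rewrite z0 {1}/z xN subr0 addr0 => zN.
  by apply: (mulIf N0); rewrite -zN; ring.
move=> k lekN; apply/eqP; rewrite -subr_eq0 -/(z k) zE ?ltnS // z1 z0.
by apply/eqP; ring.
Qed.

(** The recurrences make the diagonal affine of slope [s] and give the off-diagonal products the
    second difference [(s^2 - r^2)/2 = -2 kappa]. These products vanish at the ends 0 and [n], which
    determines them. *)
Lemma krawtchouk_entries n (M : 'M[K]_n) alpha beta r :
    [pchar K] =i pred0 -> alpha != 0 -> r != 0 ->
    irreducible_tridiagonal M ->
    dolan_grady M (diag_mx (\row_(i < n) (alpha * (val i)%:R + beta))) r ->
  exists s delta : K, let kappa := (r ^+ 2 - s ^+ 2) / 4 in
    [/\ kappa != 0, forall i : 'I_n, M i i = s * (val i)%:R + delta &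
      forall i j : 'I_n, val i = (val j).+1 ->
        M i j * M j i = kappa * (val i)%:R * (n%:R - (val i)%:R)].
Proof.
move=> charK alpha0 r0 [M3 Mirr] DG.
have natK0 k : k.+1%:R != 0 :> K by rewrite ((pcharf0P K).1 charK).
pose ent k l : K :=
  if (insub k, insub l) is (Some i, Some j) then M i j else 0.
pose y k l := if (k, l) is (k'.+1, l'.+1) then ent k' l' else 0.
have y0 l : y 0%N l = 0 by [].
have yS k l : y k.+1 l.+1 = ent k l by [].
have y_0 k : y k 0%N = 0 by case: k.
have entE (i j : 'I_n) : ent i j = M i j by rewrite /ent !valK.
have entN k l : (n <= k)%N || (n <= l)%N -> ent k l = 0.
  by rewrite /ent; case: insubP => [i ? _|//]; case: insubP => [j ? _|//]; lia.
have ent3 k l : (l.+1 < k)%N || (k.+1 < l)%N -> ent k l = 0.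
  rewrite /ent; case: insubP => [i _ <-|//]; case: insubP => [j _ <-|//] /= far.
  by apply/eqP/negPn/negP => /M3 /=; lia.
have yN k l : (n.+1 <= k)%N || (n.+1 <= l)%N -> y k l = 0.
  by case: k l => [|k] [|l] //= far; apply: entN; lia.
have y3 k l : (l.+1 < k)%N || (k.+1 < l)%N -> y k l = 0.
  by case: k l => [|k] [|l] //= far; apply: ent3; lia.
have rel k l :
    \sum_(a < n.+1) \sum_(b < n.+1)
      y k b * y b a * y a l * (l%:R - 3 * a%:R + 3 * b%:R - k%:R)
    = r ^+ 2 * (y k l * (l%:R - k%:R)).
  have [far|] := boolP ((n.+1 <= k)%N || (n.+1 <= l)%N).
    rewrite yN // mul0r mulr0 big1 // => a _; rewrite big1 // => b _.
    case/orP: far => far; first by rewrite [y k b]yN ?far //; ring.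
    by rewrite [y a l]yN ?far ?orbT //; ring.
  rewrite big_ord_recl big1 ?add0r => [|b _]; last first.
    by rewrite /= y0 mulr0 mul0r.
  case: k => [|k].
    by rewrite y0 mul0r mulr0 big1 // => a _; rewrite big1 // => b _; rewrite y0 !mul0r.
  case: l => [|l].
    by rewrite y_0 mul0r mulr0 big1 // => a _; rewrite big1 // => b _;
       rewrite y_0 mulr0 mul0r.
  rewrite negb_or -!ltnNge !ltnS => /andP[ltk ltl].
  (* The weights 1, -3, 3, -1 sum to zero, so [beta] and the index shift drop out and [alpha] is a
     common factor. *)
  apply: (mulfI alpha0); rewrite yS.
  have := dolan_grady_entry (Ordinal ltk) (Ordinal ltl) erefl DG.
  rewrite -!entE /= => relM.
  transitivity (r ^+ 2 * (ent k l * (alpha * l%:R + beta - (alpha * k%:R + beta))));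
    last by ring.
  rewrite -relM mulr_sumr; apply: eq_bigr => a _.
  rewrite big_ord_recl /= y_0 !mul0r add0r mulr_sumr.
  by apply: eq_bigr => b _; rewrite /= /bump !add1n !yS -!entE; ring.
have yE (i j : 'I_n) : y i.+1 j.+1 = M i j by exact: entE.
have sub0 k : (k.+1 < n)%N -> y k.+2 k.+1 != 0.
  move=> ltk; rewrite (yE (Ordinal ltk) (Ordinal (ltnW ltk))).
  by have [] := Mirr (Ordinal ltk) (Ordinal (ltnW ltk)) erefl.
have sup0 k : (k.+1 < n)%N -> y k.+1 k.+2 != 0.
  move=> ltk; rewrite (yE (Ordinal (ltnW ltk)) (Ordinal ltk)).
  by have [] := Mirr (Ordinal ltk) (Ordinal (ltnW ltk)) erefl.
(* For [n <= 1] the matrix does not determine a slope; the value 0 keeps [kappa = r^2/4] nonzero. *)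
pose s := if (1 < n)%N then y 2 2 - y 1%N 1%N else 0.
have diagE k : (k < n)%N -> y k.+1 k.+1 = s * k%:R + y 1%N 1%N.
  move=> ltk; rewrite (@second_difference_eq0 n (fun k => y k.+1 k.+1)) //.
    by rewrite /s; case: ltnP => // len1; rewrite (_ : k = 0%N); [ring | lia].
  by move=> {ltk}k ltk; apply: diagonal_recurrence yN y3 rel _ _ _; apply: sub0; lia.
pose kappa := (r ^+ 2 - s ^+ 2) / 4.
have offE k : (k <= n)%N -> (0 < n)%N ->
    y k.+1 k * y k k.+1 = kappa * k%:R * (n%:R - k%:R).
  move=> lekn n_gt0.
  rewrite (@second_difference_const n (fun k => y k.+1 k * y k k.+1) kappa) //.
  - by rewrite -(prednK n_gt0).
  - by rewrite mul0r.
  - by rewrite yN ?mul0r // leqnn.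
  move=> {lekn}k ltk; have := offdiagonal_recurrence yN y3 rel (sub0 k ltk).
  rewrite (diagE k (ltnW ltk)) (diagE k.+1 ltk).
  move=> rec; apply: (mulfI (natK0 1%N)); rewrite rec /kappa.
  by field; rewrite (natK0 3).
exists s, (y 1%N 1%N); split => [|i|i j ij].
- have [n_gt1|n_le1] := ltnP 1 n; last first.
    rewrite /s ltnNge n_le1 /= expr0n subr0 mulf_neq0 ?expf_neq0 //.
    by rewrite invr_eq0 (natK0 3).
  (* The off-diagonal product at index 1 is [kappa * (n - 1)], and it is nonzero by
     irreducibility. *)
  have := mulf_neq0 (sub0 0%N n_gt1) (sup0 0%N n_gt1).
  rewrite (offE 1%N (ltnW n_gt1) (ltnW n_gt1)).
  by rewrite -mulrA mulf_eq0 negb_or => /andP[].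
- by rewrite -yE diagE.
- rewrite -!yE /= in ij *; have := ltn_ord i; rewrite ij => lt_jn.
  by apply: offE; lia.
Qed.

End DolanGrady.

(** * Transfer of binary forms of degree [n.-1] to [V] *)

Section FormModel.
Context {K : fieldType} {V : vectType K}.
Local Notation n := (\dim {:V}).
Variable e : n.-tuple V.
Implicit Types (F G : 'End(V)) (b : K) (p q r s : K * K).

(** Sends ['X^i] to the [i]-th vector of [e]. Coefficients from [n] on are dropped, so it is
    faithful on polynomials of size at most [n], the dehomogenized forms. *)
Definition poly_vec (f : {poly K}) : V := \sum_(i < n) f`_i *: e`_i.

Lemma poly_vec_linear : linear poly_vec.
Proof.
move=> a f g; rewrite scaler_sumr -big_split; apply: eq_bigr => i _ /=.
by rewrite coefD coefZ scalerDl scalerA.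
Qed.
HB.instance Definition _ := GRing.isLinear.Build K {poly K} V _ poly_vec
  poly_vec_linear.

Definition vec_poly (u : V) : {poly K} := \sum_(i < n) coord e i u *: 'X^i.

Lemma vec_poly_linear : linear vec_poly.
Proof.
move=> a u w; rewrite scaler_sumr -big_split; apply: eq_bigr => i _ /=.
by rewrite linearP scalerDl scalerA.
Qed.
HB.instance Definition _ := GRing.isLinear.Build K V {poly K} _ vec_poly
  vec_poly_linear.

Definition acts_as F b p q := forall f : {poly K}, (size f <= n)%N ->
  F (poly_vec f) = poly_vec (form_op n.-1 b p q f).

Definition form_basis r s : n.-tuple V :=
  [tuple poly_vec (form_monomial n.-1 r s i) | i < n].

Lemma form_basisE r s (i : 'I_n) :
  (form_basis r s)`_i = poly_vec (form_monomial n.-1 r s i).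
Proof. by rewrite -tnth_nth tnth_mktuple. Qed.

Hypothesis eP : basis_of {:V} e.

Lemma poly_vecK (f : {poly K}) : (size f <= n)%N -> vec_poly (poly_vec f) = f.
Proof.
move=> lefn; rewrite /vec_poly.
under eq_bigr => i _ do rewrite coord_sum_free ?(basis_free eP) //.
apply/polyP => k; rewrite coef_sum; under eq_bigr => i _ do rewrite coefZ coefXn.
have [ltkn|lenk] := ltnP k n; last first.
  rewrite big1 ?nth_default ?(leq_trans lefn) // => i _.
  by rewrite (gtn_eqF (leq_trans _ lenk)) ?mulr0.
rewrite (bigD1 (Ordinal ltkn)) //= eqxx mulr1 big1 ?addr0 // => i ik.
by rewrite -val_eqE eq_sym in ik; rewrite (negPf ik) mulr0.
Qed.

Lemma acts_as_exists b p q : exists F, acts_as F b p q.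
Proof.
exists (linfun (poly_vec \o form_op n.-1 b p q \o vec_poly)) => f lefn.
by rewrite lfunE /= poly_vecK.
Qed.

Lemma acts_as_on_basis F b p q :
    (forall i : 'I_n, F e`_i = poly_vec (form_op n.-1 b p q 'X^i)) ->
  acts_as F b p q.
Proof.
move=> Fe f lefn.
have fE : f = \sum_(i < n) f`_i *: 'X^i.
  rewrite -[LHS]coefK poly_def (big_ord_widen n (fun i => f`_i *: 'X^i) lefn).
  rewrite big_mkcond; apply: eq_bigr => i _.
  by case: ltnP => // lefi; rewrite nth_default ?scale0r.
rewrite {2}fE !linear_sum /=; apply: eq_bigr => i _.
by rewrite !linearZ /= Fe.
Qed.

Lemma form_basis_app F b p q r s (i : 'I_n) : acts_as F b p q -> det r s != 0 ->
  F (form_basis r s)`_i =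
    (b + i%:R * (det r q * det p s / det r s)
       - (n.-1 - i)%:R * (det s q * det p r / det r s)) *: (form_basis r s)`_i
    - (i%:R * (det r q * det p r / det r s)) *: (form_basis r s)`_i.-1
    + ((n.-1 - i)%:R * (det s q * det p s / det r s)) *: (form_basis r s)`_i.+1.
Proof.
move=> Fpq rs0; have lt_in := ltn_ord i; have le_id : (i <= n.-1)%N by lia.
rewrite form_basisE Fpq; last first.
  by rewrite (leq_trans (size_form_monomial _ _ le_id)) //; lia.
have vecE x y z (f g h : {poly K}) : poly_vec (x *: f - y *: g + z *: h) =
    x *: poly_vec f - y *: poly_vec g + z *: poly_vec h.
  by rewrite linearD linearB !linearZ.
rewrite form_op_monomial // vecE; congr (_ - _ *: _ + _).
  have lt_i1 : (i.-1 < n)%N by lia.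
  by rewrite (form_basisE _ _ (Ordinal lt_i1)).
(* At the last index [form_basis] has no successor, but the coefficient is zero. *)
have [->|ne_id] := eqVneq (nat_of_ord i) n.-1; first by rewrite subnn mul0r !scale0r.
have lt_i1 : (i.+1 < n)%N by lia.
by rewrite (form_basisE _ _ (Ordinal lt_i1)).
Qed.

(** Both neighbour coefficients contain [det r r] or [det s s]. *)
Lemma form_basis_eigen F b r s (i : 'I_n) : acts_as F b r s -> det r s != 0 ->
  F (form_basis r s)`_i = (i%:R * det r s + b) *: (form_basis r s)`_i.
Proof.
move=> Frs rs0; rewrite (form_basis_app i Frs) // !det_same.
rewrite mulfK // !(mulr0, mul0r) !scale0r !subr0 addr0.
by rewrite addrC.
Qed.

Hypothesis charK : [pchar K] =i pred0.

Lemma eigenvalue_inj r s b : det r s != 0 ->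
  injective (fun i : 'I_n => i%:R * det r s + b).
Proof.
move=> rs0 i j /addIr/(mulIf rs0)/eqP; rewrite -subr_eq0 => /eqP ij0.
wlog leij : i j ij0 / (i <= j)%N.
  move=> th; case: (leqP i j) => [|/ltnW] le; first exact: th.
  by symmetry; apply: th => //; rewrite -opprB ij0 oppr0.
apply: val_inj; apply/eqP; rewrite /= eqn_leq leij -subn_eq0.
by rewrite -((pcharf0P K).1 charK) natrB // -opprB ij0 oppr0 eqxx.
Qed.

(** The monomials are eigenvectors of the operator attached to [r] and [s], with distinct
    eigenvalues in characteristic 0. *)
Lemma form_basisP r s : det r s != 0 -> basis_of {:V} (form_basis r s).
Proof.
move=> rs0; have [F Frs] := acts_as_exists 0 r s.
rewrite basisEfree subvf size_tuple leqnn !andbT.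
apply: (@eigenvectors_free _ _ F _ _ _ (eigenvalue_inj (b := 0) rs0)) => i;
  last exact: form_basis_eigen.
have le_id : (i <= n.-1)%N by have := ltn_ord i; lia.
have size_i : (size (form_monomial n.-1 r s i) <= n)%N.
  by rewrite (leq_trans (size_form_monomial _ _ le_id)) //; have := ltn_ord i; lia.
rewrite form_basisE; apply/eqP => /(congr1 vec_poly); rewrite linear0 poly_vecK //.
have sr0 : det s r != 0 by rewrite detC oppr_eq0.
by apply/eqP; rewrite mulf_neq0 ?expf_neq0 ?(lform_neq0 rs0) ?(lform_neq0 sr0).
Qed.

Lemma form_basis_mx F b p q r s (i j : 'I_n) : acts_as F b p q -> det r s != 0 ->
  mx_wrt (form_basis r s) F i j =
    if i == j then b + i%:R * (det r q * det p s / det r s)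
       - (n.-1 - i)%:R * (det s q * det p r / det r s)
    else if val j == i.+1 then - (j%:R * (det r q * det p r / det r s))
    else if val i == j.+1 then (n.-1 - j)%:R * (det s q * det p s / det r s)
    else 0.
Proof.
move=> Fpq rs0; have free_rs := basis_free (form_basisP rs0).
rewrite mx_wrtE (form_basis_app j Fpq) //.
move: (form_basis r s) free_rs => x x_free; rewrite linearD linearB !linearZ /=.
have coordE k : (k < n)%N -> coord x i x`_k = (k == i)%:R.
  by move=> ltk; rewrite (coord_free (Ordinal ltk)) // -val_eqE.
have lt_jn := ltn_ord j; have lt_in := ltn_ord i.
have -> : (n.-1 - j)%:R * (det s q * det p s / det r s) *
    coord x i x`_j.+1 =
    (n.-1 - j)%:R * (det s q * det p s / det r s) * (j.+1 == i)%:R.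
  have [ltj|] := ltnP j.+1 n; first by rewrite coordE.
  by move=> le; rewrite (_ : n.-1 - j = 0)%N; [rewrite !mul0r | lia].
rewrite !coordE //; last by lia.
rewrite -(inj_eq val_inj) /= [_ == nat_of_ord j]eq_sym.
have [->|ji] := eqVneq (nat_of_ord j) i.
  have [jE|_] := eqVneq i.-1 i; last by rewrite (gtn_eqF (ltnSn i)) /=; ring.
  by rewrite (gtn_eqF (ltnSn i)) (_ : nat_of_ord i = 0%N); [rewrite /=; ring | lia].
have [->|ji1] := eqVneq (nat_of_ord j) i.+1.
  by rewrite eqxx (gtn_eqF (leqW (ltnSn i))) /=; ring.
rewrite [nat_of_ord i == _]eq_sym.
have [_|ij1] := eqVneq (nat_of_ord j).+1 i.
  by rewrite (_ : (j.-1 == i) = false); [rewrite /=; ring | lia].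
have [jE|_] := eqVneq j.-1 i; last by rewrite /=; ring.
by rewrite (_ : nat_of_ord j = 0%N); [rewrite /=; ring | lia].
Qed.

Lemma form_basis_tridiagonal F b p q r s :
  acts_as F b p q -> det r s != 0 -> tridiagonal (mx_wrt (form_basis r s) F).
Proof.
move=> Fpq rs0 i j; rewrite (form_basis_mx i j Fpq) // -(inj_eq val_inj).
by do !case: ifP; rewrite ?eqxx //= => *; lia.
Qed.

(** The product is a factor of every superdiagonal entry; it vanishes when [r] is proportional to
    [p] or [q]. *)
Lemma form_basis_lower F b p q r s : acts_as F b p q -> det r s != 0 ->
  det r q * det p r = 0 -> lower_bidiagonal (mx_wrt (form_basis r s) F).
Proof.
move=> Fpq rs0 pq0 i j; rewrite (form_basis_mx i j Fpq) // -(inj_eq val_inj).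
rewrite pq0 mul0r mulr0 oppr0.
by do !case: ifP; rewrite ?eqxx //= => *; lia.
Qed.

Lemma form_basis_upper F b p q r s : acts_as F b p q -> det r s != 0 ->
  det s q * det p s = 0 -> upper_bidiagonal (mx_wrt (form_basis r s) F).
Proof.
move=> Fpq rs0 pq0 i j; rewrite mxE (form_basis_mx j i Fpq) // -(inj_eq val_inj).
rewrite pq0 mul0r mulr0 [val j == val i]eq_sym.
by do !case: ifP; rewrite ?eqxx //= => *; lia.
Qed.

Lemma form_basis_standard F G b c p q r s :
    acts_as F b r s -> acts_as G c p q -> det r s != 0 ->
    det r q != 0 -> det p r != 0 -> det s q != 0 -> det p s != 0 ->
  standard_fst F G (form_basis r s).
Proof.
move=> Frs Gpq rs0 rq0 pr0 sq0 ps0; have xP := form_basisP rs0; split=> //.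
  by rewrite (mx_wrt_diagP xP (fun i => form_basis_eigen i Frs rs0)) diag_mx_is_diag.
split=> [|i j ij]; first exact: form_basis_tridiagonal Gpq rs0.
have natK0 k : (0 < k)%N -> k%:R != 0 :> K.
  by rewrite ((pcharf0P K).1 charK) lt0n.
have lt_in := ltn_ord i; rewrite /= in ij.
rewrite !(form_basis_mx _ _ Gpq) // -!(inj_eq val_inj) /= ij eqxx.
rewrite (gtn_eqF (ltnSn j)) (ltn_eqF (ltnSn j)) (ltn_eqF (leqW (ltnSn j))).
rewrite oppr_eq0 !mulf_neq0 ?invr_eq0 ?natK0 //; lia.
Qed.

(** The two determinant equations express that [F] shares the point [r] with the basis and [G] the
    point [s]. *)
Lemma form_standard_split A Astar F G b1 b2 b3 b4 p q r s p1 q1 p2 q2 v :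
    det r s != 0 -> acts_as A b1 r s -> acts_as Astar b2 p q ->
    acts_as F b3 p1 q1 -> acts_as G b4 p2 q2 ->
    det r q1 * det p1 r = 0 -> det s q2 * det p2 s = 0 ->
  standard_fst A Astar v -> split_basis F G v.
Proof.
move=> rs0 Ars Apq Fpq Gpq F0 G0.
apply: (standard_split (form_basisP rs0) (eigenvalue_inj (b := b1) rs0)).
- by move=> i; apply: form_basis_eigen.
- exact: form_basis_tridiagonal Apq rs0.
- exact: form_basis_lower Fpq rs0 F0.
- exact: form_basis_upper Gpq rs0 G0.
Qed.

End FormModel.

(** * Normal form of a Leonard pair with arithmetic sequences *)

Section NormalForm.
Context {K : fieldType} {V : vectType K}.
Local Notation n := (\dim {:V}).
Implicit Types (A Astar F G : 'End(V)) (v w e : n.-tuple V).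

(** The relation holds in a basis exactly when the endomorphism [E] is zero, hence in all bases or
    in none. *)
Lemma mx_wrt_dolan_grady v w F G r : basis_of {:V} v -> basis_of {:V} w ->
  dolan_grady (mx_wrt w F) (mx_wrt w G) r ->
  dolan_grady (mx_wrt v F) (mx_wrt v G) r.
Proof.
move=> vP wP.
pose E := ((F \o F \o F \o G) - (F \o F \o G \o F) *+ 3
  + (F \o G \o F \o F) *+ 3 - (G \o F \o F \o F)
  - r ^+ 2 *: ((F \o G) - (G \o F)))%VF.
have mxE (u : n.-tuple V) : basis_of {:V} u ->
    dolan_grady (mx_wrt u F) (mx_wrt u G) r <-> mx_wrt u E = 0.
  move=> uP; rewrite /dolan_grady -!mx_wrt_comp //.
  pose L := mx_wrt u : {linear 'End(V) -> 'M[K]_n}; rewrite -[mx_wrt u]/(L : _ -> _).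
  rewrite -!(raddfMn L, raddfB L, raddfD L) -(linearZ_LR L).
  by split=> [LE|/eqP]; [rewrite /E linearB LE subrr | rewrite linearB subr_eq0 => /eqP].
move=> /(mxE w wP); rewrite -(linear0 (mx_wrt w)) => /(mx_wrt_inj wP) E0.
by apply/(mxE v vP); rewrite E0 linear0.
Qed.

Lemma acts_as_mx e F b p q : basis_of {:V} e ->
    (forall i j : 'I_n, mx_wrt e F i j = (form_op n.-1 b p q 'X^j)`_i) ->
  acts_as e F b p q.
Proof.
move=> eP FE; apply: acts_as_on_basis => j.
by rewrite mx_wrt_app //; apply: eq_bigr => i _; rewrite FE.
Qed.

Lemma normal_form A Astar : [pchar K] =i pred0 ->
    (exists theta, eigenvalue_sequence A Astar theta /\ arithmetic theta) ->
    (exists theta, dual_eigenvalue_sequence A Astar theta /\ arithmetic theta) ->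
  exists e b bstar p q r s,
    [/\ basis_of {:V} e, acts_as e A b p q, acts_as e Astar bstar r s,
        det p q != 0 /\ det r s != 0
      & [/\ det p r != 0, det p s != 0, det q r != 0 & det q s != 0]].
Proof.
move=> charK [theta [[v [vP _ Astar_irr] Av] [theta_inj [alpha [beta [alpha0 thetaE]]]]]].
move=> [t [[w [wP _ [A3 _]] Astarw] [_ [r [b [r0 tE]]]]]].
have natK0 k : (0 < k)%N -> k%:R != 0 :> K.
  by rewrite ((pcharf0P K).1 charK) lt0n.
have AE := mx_wrt_diagP vP Av.
(* The relation is checked in [w], where [Astar] is diagonal, and then read in [v], where [A] is. *)
have DG : dolan_grady (mx_wrt v Astar) (mx_wrt v A) r.
  apply: (mx_wrt_dolan_grady vP wP).
  exact: (tridiagonal_dolan_grady (mx_wrt_diagP wP Astarw) tE A3).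
have thetaM : \row_i theta i = \row_(i < n) (alpha * (val i)%:R + beta).
  by apply/rowP => i; rewrite !mxE thetaE.
rewrite AE thetaM in DG.
have [s [delta [kappa0 Mdiag Moff]]] :=
  krawtchouk_entries charK alpha0 r0 Astar_irr DG.
set kappa := _ / 4 in kappa0 Moff; set M := mx_wrt v Astar in Astar_irr Mdiag Moff.
have [M3 Mirr] := Astar_irr.
(* [m k] is the subdiagonal entry in column [k]; the default 1 makes it nonzero for every [k]. *)
pose m k := if (insub k.+1, insub k) is (Some i, Some j) then M i j else 1.
have mE (i j : 'I_n) : val i = (val j).+1 -> m j = M i j.
  by rewrite /m => <-; rewrite !valK.
have m0 k : m k != 0.
  rewrite /m; case: insubP => [i _ ik|_]; last exact: oner_neq0.
  case: insubP => [j _ jk|_]; last exact: oner_neq0.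
  by have [] := Mirr i j (etrans ik (congr1 succn (esym jk))).
(* The rescaling makes the subdiagonal entries of A* equal to d, d - 1, ..., 1,
   as for the form_op of two linear forms with leading coefficient 1. *)
pose c := fix c k : K := if k is k'.+1 then c k' * m k' / (n.-1 - k')%:R else 1.
have c0 k : (k < n)%N -> c k != 0.
  elim: k => [|k IHk] ltk; first exact: oner_neq0.
  by rewrite /= !mulf_neq0 ?invr_eq0 ?m0 ?natK0 ?IHk //; lia.
pose e := [tuple c i *: v`_i | i < n].
have eE (i : 'I_n) : e`_i = c i *: v`_i by rewrite -tnth_nth tnth_mktuple.
have Ae (i : 'I_n) : A e`_i = theta i *: e`_i.
  by rewrite eE linearZ /= Av !scalerA mulrC.
have eP : basis_of {:V} e.
  rewrite basisEfree subvf size_tuple leqnn !andbT.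
  apply: (eigenvectors_free theta_inj _ Ae) => i.
  rewrite eE scaler_eq0 negb_or c0 //=.
  by apply: basis_not0 vP _; rewrite mem_nth ?size_tuple.
(* By l12 these are the eigenvalues of the 2 x 2 matrix [[0, 1], [kappa, s]]. *)
pose l1 := (s + r) / 2; pose l2 := (s - r) / 2.
have two0 : 2 != 0 :> K by exact: natK0.
have four0 : 4 != 0 :> K by exact: natK0.
have l12 : l1 * l2 = - kappa by rewrite /l1 /l2 /kappa; field; rewrite two0 four0.
have [l1_0 l2_0] : l1 != 0 /\ l2 != 0.
  by apply/andP; rewrite -negb_or -mulf_eq0 l12 oppr_eq0.
(* The first two forms are [- alpha X] and 1, so the operator is [f |-> alpha X f' + beta f],
   diagonal on powers of [X]. The other two are [X - l2] and [X - l1]; the summand [n.-1 * l2]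
   cancels their constant diagonal term. The roots 0, infinity, [l2], [l1] are distinct since
   [l1 * l2 = - kappa] and [l1 - l2 = r]. *)
exists e, beta, (delta + n.-1%:R * l2), (0, - alpha), (1, 0), (- l2, 1), (- l1, 1).
split=> //.
- apply: acts_as_mx => // i j; rewrite (mx_wrt_diagP eP Ae) !mxE.
  have -> : form_op n.-1 beta (0, - alpha) (1, 0) 'X^j = theta j *: 'X^j.
    rewrite thetaE /form_op deriv_lform /lform /= derivXn -!mul_polyC.
    by case: (nat_of_ord j) => [|k]; rewrite ?exprS /=; ring.
  rewrite coefZ coefXn val_eqE; case: eqVneq => [->|_]; first by rewrite mulr1.
  by rewrite mulr0.
- apply: acts_as_mx => // i j.
  have -> : form_op n.-1 (delta + n.-1%:R * l2) (- l2, 1) (- l1, 1) 'X^j =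
      (n.-1%:R - j%:R) *: 'X^(j.+1) + (s * j%:R + delta) *: 'X^j
        + (kappa * j%:R) *: 'X^(j.-1).
    rewrite /form_op deriv_lform /lform /= derivXn -!mul_polyC.
    have -> : kappa = - (l1 * l2) by rewrite l12 opprK.
    have -> : s = l1 + l2 by rewrite /l1 /l2; field.
    by case: (nat_of_ord j) => [|k]; rewrite ?exprS /=; ring.
  rewrite (mx_wrt_rescale Astar eP vP (@inj_id _) (fun j => c0 j (ltn_ord j)) eE) -/M.
  rewrite !coefD !coefZ !coefXn.
  have lt_in := ltn_ord i; have lt_jn := ltn_ord j.
  have [ij|ij] := eqVneq (nat_of_ord i) j.+1.
    rewrite (gtn_eqF (_ : j < i)%N) ?(gtn_eqF (_ : j.-1 < i)%N);
      [|by rewrite ij // ltnS leq_pred..].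
    rewrite -(mE i j ij) ij /= -natrB; last by clear -lt_jn; lia.
    have nj0 : (n.-1 - j)%:R != 0 :> K by apply: natK0; clear -ij lt_in; lia.
    by field; rewrite nj0 m0 c0.
  have [ij'|ij'] := eqVneq (nat_of_ord i) j.
    have -> : i = j by apply: val_inj.
    have -> : (kappa * j%:R) * ((nat_of_ord j == j.-1)%:R : K) = 0.
      by case: (nat_of_ord j) => [|k] /=; rewrite ?(gtn_eqF (ltnSn _)) /=; ring.
    by rewrite Mdiag divff ?c0 //=; ring.
  (* On the superdiagonal the rescaling gives [m i * M i j / (n.-1 - i)]; the product formula [Moff]
     reduces this to [kappa * j]. *)
  have [ji|ji] := eqVneq (nat_of_ord j) i.+1.
    have jE : (nat_of_ord i == j.-1) by rewrite ji.
    have nj0 : (n.-1 - i)%:R != 0 :> K by apply: natK0; clear -ji lt_jn; lia.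
    have Mji := Moff j i ji; rewrite -(mE j i ji) in Mji.
    rewrite jE ji /=.
    transitivity ((m i * M i j) / (n.-1 - i)%:R); first by field; rewrite nj0 c0.
    rewrite Mji /= ji (_ : n%:R - i.+1%:R = (n.-1 - i)%:R :> K).
      by field.
    by rewrite -natrB ?lt_jn //; congr (_ %:R); clear -ji lt_jn; lia.
  have -> : M i j = 0.
    by apply/eqP/negPn/negP => /M3 /=; rewrite !(negPf ij, negPf ij', negPf ji).
  have -> : (kappa * j%:R) * ((nat_of_ord i == j.-1)%:R : K) = 0.
    have [ji'|_] := eqVneq (nat_of_ord i) j.-1; last by rewrite mulr0.
    by rewrite (_ : nat_of_ord j = 0%N); [ring | clear -ji ji' ij'; lia].
  by rewrite /=; ring.
- rewrite /det /=; split; first by rewrite (_ : _ - _ = alpha) //; ring.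
  by rewrite (_ : _ - _ = r) // /l1 /l2; field.
- rewrite /det /=; split; rewrite ?(mul0r, sub0r, mul1r, mulr1, subr0, oner_neq0) //.
  all: by rewrite mulrNN oppr_eq0 mulf_neq0.
Qed.

End NormalForm.

(** * The three pairings of four points and their adjacency *)

Theorem theorem9p1 (K : fieldType) (charK0 : [pchar K] =i pred0)
    (V : vectType K) (dimV_gt0 : (0 < \dim {:V})%N)
    (A Astar : 'End(V)) (leonardA : Leonard_pair A Astar)
    (arith_eigenvalues : exists theta : 'I_(\dim {:V}) -> K,
        eigenvalue_sequence A Astar theta /\ arithmetic theta)
    (arith_dual_eigenvalues : exists thetastar : 'I_(\dim {:V}) -> K,
        dual_eigenvalue_sequence A Astar thetastar /\ arithmetic thetastar) :
  exists B Bstar C Cstar : 'End(V),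
    [/\ Leonard_pair B Bstar, Leonard_pair C Cstar,
        adjacent A Astar B Bstar, adjacent A Astar C Cstar
      & adjacent B Bstar C Cstar].
Proof.
have [e [b [bstar [p [q [r [s [eP Apq Ars [pq0 rs0] [pr0 ps0 qr0 qs0]]]]]]]]] :=
  normal_form charK0 arith_eigenvalues arith_dual_eigenvalues.
have [B Bpr] := acts_as_exists eP 0 p r.
have [Bstar Bqs] := acts_as_exists eP 0 q s.
have [C Cps] := acts_as_exists eP 0 p s.
have [Cstar Cqr] := acts_as_exists eP 0 q r.
have [qp0 sr0 rp0 sp0] :
    [/\ det q p != 0, det s r != 0, det r p != 0 & det s p != 0].
  by split; rewrite detC oppr_eq0.
have [rq0 sq0] : det r q != 0 /\ det s q != 0 by split; rewrite detC oppr_eq0.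
exists B, Bstar, C, Cstar; split.
- by split; eexists; [apply: (form_basis_standard eP charK0 Bpr Bqs) |
                      apply: (form_basis_standard eP charK0 Bqs Bpr)].
- by split; eexists; [apply: (form_basis_standard eP charK0 Cps Cqr) |
                      apply: (form_basis_standard eP charK0 Cqr Cps)].
(* In each case both maps on the other side share one point with the pair defining the basis, so a
   factor [det x x] vanishes. *)
- split=> v [] vstd.
  + by apply: (form_standard_split eP charK0 pq0 Apq Ars Bpr Bqs _ _ vstd);
      rewrite det_same ?(mulr0, mul0r).
  + by apply: (form_standard_split eP charK0 rs0 Ars Apq Bpr Bqs _ _ vstd);
      rewrite det_same ?(mulr0, mul0r).
  + by apply: (form_standard_split eP charK0 pr0 Bpr Bqs Apq Ars _ _ vstd);
      rewrite det_same ?(mulr0, mul0r).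
  + by apply: (form_standard_split eP charK0 qs0 Bqs Bpr Apq Ars _ _ vstd);
      rewrite det_same ?(mulr0, mul0r).
- split=> v [] vstd.
  + by apply: (form_standard_split eP charK0 pq0 Apq Ars Cps Cqr _ _ vstd);
      rewrite det_same ?(mulr0, mul0r).
  (* Here [r], the first point of [Astar], belongs to [Cstar] and [s] to [C], so the two maps are
     taken in the opposite order. *)
  + apply: split_basis_sym.
    by apply: (form_standard_split eP charK0 rs0 Ars Apq Cqr Cps _ _ vstd);
      rewrite det_same ?(mulr0, mul0r).
  + by apply: (form_standard_split eP charK0 ps0 Cps Cqr Apq Ars _ _ vstd);
      rewrite det_same ?(mulr0, mul0r).
  + by apply: (form_standard_split eP charK0 qr0 Cqr Cps Apq Ars _ _ vstd);
      rewrite det_same ?(mulr0, mul0r).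
- split=> v [] vstd.
  + by apply: (form_standard_split eP charK0 pr0 Bpr Bqs Cps Cqr _ _ vstd);
      rewrite det_same ?(mulr0, mul0r).
  + apply: split_basis_sym.
    by apply: (form_standard_split eP charK0 qs0 Bqs Bpr Cqr Cps _ _ vstd);
      rewrite det_same ?(mulr0, mul0r).
  + by apply: (form_standard_split eP charK0 ps0 Cps Cqr Bpr Bqs _ _ vstd);
      rewrite det_same ?(mulr0, mul0r).
  + apply: split_basis_sym.
    by apply: (form_standard_split eP charK0 qr0 Cqr Cps Bqs Bpr _ _ vstd);
      rewrite det_same ?(mulr0, mul0r).
Qed.
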